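(* In the typical setting below, the element $w=y^{r-1}\sum_{m=1}^{p-1}\chi(m)^{-1}\sigma^m$ lies in $H$, $H=K[w]$ (i.e. $1,w,\dots,w^{p-1}$ is a $K$-basis of $H$), and there is a unit $\varepsilon\in\mathbb{Z}_p^\times$ such that $w^p=\varepsilon\, p\, y^{(p-1)(r-1)}\,w$.
   Context: Typical setting: $p$ is an odd prime, $K$ a finite extension of $\mathbb{Q}_p$ with absolute ramification index $e$, and $L/K$ a degree $p$ extension whose normal closure $\widetilde L$ is totally ramified over $K$. Then $G=\mathrm{Gal}(\widetilde L/K)\cong C_p\rtimes C_r$ with $r=[\widetilde L:L]$ dividing $p-1$. Let $J$ be the unique subgroup of order $p$ of $G$, $M=\widetilde L^J$, $G'=\mathrm{Gal}(\widetilde L/L)$. The ramification jump $t$ is the integer with $G_t=J$, $G_{t+1}=1$ (lower numbering); one has $1\le t\le rpe/(p-1)$. Assume $L/K$ is typical, i.e. $p\nmid t$ (equivalently $t<rpe/(p-1)$). Let $c$ be the remainder of $t$ mod $r$ (then $\gcd(c,r)=1$), $b=(t-pc)/r\in\mathbb{Z}$, $\ell=cp+b=\frac{pc(r-1)+t}{r}$, $a$ the remainder of $\ell$ mod $p$ (so $1\le a\le p-1$), $a_0=\lfloor\ell/p\rfloor$. By Elder's theorem there are $x\in L$ with $L=K(x)$ and $\alpha,\beta\in K$ with $v_K(\alpha)=c$, $v_K(\beta)=-b$, $x^p-\alpha^{(p-1)/r}x-\beta=0$, and $y\in M$ with $y^r=\alpha$, $M=K(y)$, $\widetilde L=L(y)$;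 and generators $\sigma$ of $J$, $\tau$ of $G'$ with $\tau\sigma\tau^{-1}=\sigma^g$ for an integer $g$ whose class mod $p$ has order $r$, $\sigma(y)=y$, $\tau(x)=x$, $\tau(y)=\chi(g)y$, where $\chi:\mathbb{Z}/p\mathbb{Z}\to\mathbb{Z}_p$ is the Teichmüller character (the unique multiplicative section of reduction mod $p$). The unique Hopf–Galois structure on $L/K$ is $H=M[J]^{G'}=\{h\in M[J]:\tau(h)=h\}$, where $G'$ acts on coefficients in $M$ by the Galois action and on $J$ by conjugation; $H$ acts on $L$ by restricting the natural action of $M[J]$ on $\widetilde L$. *)

(* Defs.v *)
From HB Require Import structures.
From mathcomp Require Import all_boot all_order all_algebra all_fingroup all_field.
Set Implicit Arguments. Unset Strict Implicit. Unset Printing Implicit Defensive.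
Import Order.TTheory GRing.Theory Num.Theory.
Local Open Scope ring_scope.

Section Valuations.
Variable F : fieldType.

(* [vge v x n] : "v(x) >= n", with the convention v(0) = +oo. *)
Definition vge (v : F -> int) (x : F) (n : int) : Prop := x = 0 \/ n <= v x.

(* v is a normalized discrete valuation on F (v is only meaningful on F^x). *)
Definition is_ndvaluation (v : F -> int) : Prop :=
  [/\ forall x y, x != 0 -> y != 0 -> v (x * y) = v x + v y,
      forall x y, x != 0 -> y != 0 -> x + y != 0 -> Num.min (v x) (v y) <= v (x + y)
    & exists pi, pi != 0 /\ v pi = 1].

Definition v_complete (v : F -> int) : Prop :=
  forall u : nat -> F,
    (forall N : int, exists n0, forall m n, (n0 <= m)%N -> (n0 <= n)%N -> vge v (u m - u n) N) ->
    exists l, forall N : int, exists n0, forall n, (n0 <= n)%N -> vge v (u n - l) N.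

Definition v_finite_residue (v : F -> int) : Prop :=
  exists s : seq F, forall x, vge v x 0 -> exists2 z, z \in s & vge v (x - z) 1.

(* F with v is a finite extension of Q_p with its normalized valuation:
   a complete discretely valued field of characteristic 0 with finite
   residue field of characteristic p. *)
Definition padic_local_field (p : nat) (v : F -> int) : Prop :=
  [/\ prime p, [pchar F] =i pred0, is_ndvaluation v, v_complete v
    & v_finite_residue v /\ ((p%:R : F) != 0 /\ 0 < v p%:R)].

(* Z_p inside F: the closure of Z *)
Definition in_Zp (v : F -> int) (x : F) : Prop :=
  forall N : int, exists z : int, vge v (x - z%:~R) N.

Definition in_Zp_units (v : F -> int) (x : F) : Prop :=
  in_Zp v x /\ x != 0 /\ v x = 0.

Definition is_teichmuller (p : nat) (v : F -> int) (chi : 'F_p -> F) : Prop :=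
  [/\ forall m n, chi (m * n) = chi m * chi n,
      forall m, in_Zp v (chi m)
    & forall m : 'F_p, exists2 z : F, in_Zp v z & chi m - (m : nat)%:R = p%:R * z].
End Valuations.
Arguments is_teichmuller {F} p v chi.

Section GroupAlgebra.
Variables (K : fieldType) (Lt : splittingFieldType K).
Local Notation G := (gal_of (fullv : {vspace Lt})).

(* elements of the group algebra Lt[G], as coefficient functions G -> Lt.
   NB: MathComp's product on gal_of is reversed composition:
   (s * t)%g a = t (s a).  We use functional composition (s o t) as the
   group law of the group algebra, as in the paper: the coefficient of h in
   f g is  sum_{k o k' = h} f(k) g(k'), and k o k' = (k' * k)%g. *)
Definition galg := {ffun G -> Lt}.

Definition galg_one : galg := [ffun h : G => ((h == 1%g)%:R : Lt)].
Definition galg_mul (f g : galg) : galg :=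
  [ffun h : G => \sum_(k : G) f k * g (h * k^-1)%g].
Definition galg_exp (f : galg) (n : nat) : galg := iter n (galg_mul f) galg_one.
Definition galg_scale (a : Lt) (f : galg) : galg := [ffun h : G => a * f h].

Definition in_MJ (M : {vspace Lt}) (J : {set G}) (f : galg) : Prop :=
  forall h, f h \in M /\ (h \notin J -> f h = 0).

(* the action of tau in G on M[J]: on coefficients by Galois action,
   on J by conjugation:  tau . (sum m_h h) = sum tau(m_h) (tau o h o tau^-1);
   tau o h o tau^-1 = (tau^-1 * h * tau)%g, so the coefficient of h' in
   tau . f is tau (f (tau * h' * tau^-1)%g). *)
Definition galg_act (tau : G) (f : galg) : galg :=
  [ffun h : G => tau (f (tau * h * tau^-1)%g)].

(* H = M[J]^{G'} with G' = <tau> *)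
Definition in_H (M : {vspace Lt}) (J : {set G}) (tau : G) (f : galg) : Prop :=
  in_MJ M J f /\ galg_act tau f = f.
End GroupAlgebra.

(* Main.v *)
Require Import Defs.
From HB Require Import structures.
From mathcomp Require Import all_boot all_order all_algebra all_fingroup all_field.
From mathcomp Require Import cyclic.
Import Order.TTheory GRing.Theory Num.Theory.
Set Implicit Arguments.
Unset Strict Implicit.
Local Open Scope group_scope.
Local Open Scope ring_scope.

(**
Put theta = \sum_(m != 0) chi(m)^-1 sigma^m, so that w = y^(r-1) theta and
w^i = y^((r-1)i) theta^i. The substitution sigma -> sigma^u multiplies theta^i by
chi(u)^i, so the coefficient of theta^i at sigma^m is chi(m)^-i f_i for m != 0,
where f_i is the coefficient at sigma. Moreover theta^(p-1) = f_(p-1) (N - p) with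
N the norm element, which annihilates theta; hence theta^p = - p f_(p-1) theta.

Each f_i with 0 < i < p lies in Z_p and is a unit. Indeed it reduces to the
corresponding coefficient over 'F_p, where the moments M_k(h) = \sum_m h(m) m^k
(k < p) turn convolution powers of m |-> m^-1 into powers of a truncated
exponential generating series, so that M_i(theta^i) = (-1)^i i! is nonzero.

Hence Fourier inversion on 'F_p^* gives freeness of 1, w, ..., w^(p-1) over K,
and expands each element of M[J] in these powers with coefficients in M;
for an element of H these coefficients are fixed by tau, so lie in M :&: L = K.
*)

(** * Characters of ['F_p] with values in a field, and convolution powers of their inverses *)

Section TwistedSums.
Variables (p : nat) (F : fieldType) (psi : 'F_p -> F).
Hypotheses (p_pr : prime p) (p_odd : odd p).
Hypothesis psiM : forall m n, psi (m * n) = psi m * psi n.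
Hypothesis psi_inj : injective psi.

Lemma mult_inj1 : psi 1 = 1.
Proof.
have /eqP: psi 1 * (psi 1 - 1) = 0 by rewrite mulrBr mulr1 -psiM mulr1 subrr.
rewrite mulf_eq0 subr_eq0 => /orP[/eqP p10|/eqP//].
have /eqP: psi 0 = psi 1 by rewrite -[0]mulr1 psiM p10 mulr0.
by rewrite (inj_eq psi_inj) eq_sym oner_eq0.
Qed.

Lemma mult_inj0 : psi 0 = 0.
Proof.
have /eqP: psi 0 * (psi 0 - 1) = 0 by rewrite mulrBr mulr1 -psiM mulr0 subrr.
rewrite mulf_eq0 subr_eq0 => /orP[/eqP//|]; rewrite -mult_inj1.
by rewrite (inj_eq psi_inj) eq_sym oner_eq0.
Qed.

Lemma mult_inj_eq0 m : (psi m == 0) = (m == 0).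
Proof. by rewrite -[in LHS]mult_inj0 (inj_eq psi_inj). Qed.

Lemma mult_injX m n : psi (m ^+ n) = psi m ^+ n.
Proof. by elim: n => [|n IH]; rewrite ?expr0 ?mult_inj1 // !exprS psiM IH. Qed.

Lemma mult_injV m : psi m^-1 = (psi m)^-1.
Proof.
have [->|m0] := eqVneq m 0; first by rewrite invr0 mult_inj0 invr0.
apply: (mulfI (x := psi m)); first by rewrite mult_inj_eq0.
by rewrite -psiM !divff ?mult_inj1 ?mult_inj_eq0.
Qed.

Lemma card_Fp_nz : #|[pred m : 'F_p | m != 0]| = p.-1.
Proof.
rewrite -[in RHS](card_Fp p_pr) -(cardC1 (0 : 'F_p)).
by apply: eq_card => m; rewrite !inE.
Qed.

Lemma Fp_prim_root : exists2 u : 'F_p, p.-1.-primitive_root u & u != 0.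
Proof.
pose rs := enum [pred m : 'F_p | m != 0].
have p1 : (0 < p.-1)%N by rewrite -subn1 subn_gt0 prime_gt1.
suff /hasP[u u0 pu] : has p.-1.-primitive_root rs.
  by exists u => //; move: u0; rewrite mem_enum inE.
apply: has_prim_root => //.
- apply/allP => m; rewrite mem_enum inE unity_rootE => m0.
  apply/eqP; apply: (mulfI m0).
  by rewrite -exprS prednK ?prime_gt0 // mulr1 -[X in _ ^+ X](card_Fp p_pr) expf_card.
- exact: enum_uniq.
- by rewrite -cardE card_Fp_nz.
Qed.

(** Orthogonality of characters: replacing m by u m, with u a primitive root, multiplies the sum by
    [psi u ^+ j / psi u ^+ i], which differs from 1 because u has order p - 1 and [psi] is
    injective. *)
Lemma sum_mult_inj i j : (i != j %[mod p.-1])%N ->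
  \sum_(m : 'F_p | m != 0) psi m ^+ j * (psi m)^-1 ^+ i = 0.
Proof.
move=> nij; have [u pu u0] := Fp_prim_root; set S := \sum_(_ | _) _.
have eS : S = psi u ^+ j * (psi u)^-1 ^+ i * S.
  rewrite {1}/S (reindex_inj (mulfI u0)) /= mulr_sumr; apply: eq_big => m.
    by rewrite mulf_eq0 negb_or u0.
  by rewrite psiM invfM !exprMn mulrACA.
apply/eqP; apply: contraNT nij => S0; move/eqP: eS.
rewrite -{1}[S]mul1r (inj_eq (mulIf S0)) exprVn eq_sym.
rewrite (can2_eq (mulfVK _) (mulfK _)) ?expf_neq0 ?mult_inj_eq0 // mul1r.
by rewrite -!mult_injX (inj_eq psi_inj) (eq_prim_root_expr pu) eq_sym.
Qed.

Lemma sum_mult_inj_diag j :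
  \sum_(m : 'F_p | m != 0) psi m ^+ j * (psi m)^-1 ^+ j = p.-1%:R.
Proof.
rewrite (eq_bigr (fun=> 1)) ?sumr_const ?card_Fp_nz // => m m0.
by rewrite -exprMn divff ?expr1n // mult_inj_eq0.
Qed.

(** The coefficient of theta^i at sigma^m. The index n = 0 contributes nothing, since [psi 0 = 0]
    and the inverse of 0 is 0 by convention. *)
Fixpoint tpow i : 'F_p -> F :=
  if i is i'.+1 then fun m => \sum_n (psi n)^-1 * tpow i' (m - n)
  else fun m => (m == 0)%:R.

Lemma tpow1 m : tpow 1 m = (psi m)^-1.
Proof.
rewrite /= (bigD1 m) //= subrr eqxx mulr1 big1 ?addr0 // => n.
by rewrite eq_sym -subr_eq0 => /negPf->; rewrite mulr0.
Qed.

Lemma tpowM i u m : u != 0 -> tpow i (u * m) = (psi u)^-1 ^+ i * tpow i m.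
Proof.
move=> u0; elim: i m => [|i IH] m /=; first by rewrite mulf_eq0 (negPf u0) mul1r.
rewrite (reindex_inj (mulfI u0)) mulr_sumr; apply: eq_bigr => n _.
by rewrite -mulrBr IH psiM invfM exprS mulrACA.
Qed.

Lemma tpow_scale i m : m != 0 -> tpow i m = (psi m)^-1 ^+ i * tpow i 1.
Proof. by move=> m0; rewrite -tpowM ?mulr1. Qed.

(** The augmentation is multiplicative, and that of theta is a sum of a character over the nonzero
    classes; the character is nontrivial because p > 2. *)
Lemma sum_tpow i : (0 < i)%N -> \sum_m tpow i m = 0.
Proof.
case: i => // i _; rewrite exchange_big /=.
have eqs n : \sum_m (psi n)^-1 * tpow i (m - n) = (psi n)^-1 * \sum_m tpow i m.
  rewrite -mulr_sumr; congr (_ * _).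
  by rewrite (reindex_inj (addIr n)); apply: eq_bigr => m _; rewrite addrK.
rewrite (eq_bigr _ (fun n _ => eqs n)) -mulr_suml (bigD1 0) //= mult_inj0 invr0 add0r.
rewrite (_ : \sum_(_ | _) _ = 0) ?mul0r //.
rewrite -[RHS](@sum_mult_inj 1 0) ?mod0n //.
  by apply: eq_bigr => n _; rewrite expr0 mul1r.
by move: p_odd (prime_gt1 p_pr); case: (p) => [|[|[|[|]]]].
Qed.

Lemma tpow_p m : tpow p m = - p%:R * tpow p.-1 1 * tpow 1 m.
Proof.
have p0 := prime_gt0 p_pr; have p1 := prime_gt1 p_pr.
have psiX n : n != 0 -> (psi n)^-1 ^+ p.-1 = 1.
  move=> n0; rewrite exprVn -mult_injX (_ : n ^+ _ = 1) ?mult_inj1 ?invr1 //.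
  apply: (mulfI n0).
  by rewrite -exprS prednK // mulr1 -[X in _ ^+ X](card_Fp p_pr) expf_card.
have eqn n : n != 0 -> tpow p.-1 n = tpow p.-1 1.
  by move=> n0; rewrite tpow_scale // psiX // mul1r.
(* The coefficients away from 0 all agree, so vanishing augmentation forces the one at 0. *)
have eq0 : tpow p.-1 0 = - (p.-1%:R * tpow p.-1 1).
  apply/eqP; rewrite -addr_eq0; apply/eqP.
  have p10 : (0 < p.-1)%N by rewrite -subn1 subn_gt0.
  rewrite -[RHS](sum_tpow p10) (bigD1 0) //=; congr (_ + _).
  by rewrite (eq_bigr _ eqn) sumr_const card_Fp_nz mulr_natl.
rewrite tpow1 -{1}(prednK p0) /=.
(* This is theta^(p-1) = f_(p-1) (N - p), read coefficientwise: a constant function plus a multiple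
   of the delta at 0. *)
have eqt n : tpow p.-1 (m - n) = tpow p.-1 1 - p%:R * tpow p.-1 1 * (n == m)%:R.
  have [->|nmn] := eqVneq n m; last by rewrite mulr0 subr0 eqn // subr_eq0 eq_sym.
  have -> : p%:R = p.-1%:R + 1 :> F by rewrite natr1 prednK.
  by rewrite subrr eq0 mulr1 mulrDl mul1r opprD addrCA subrr addr0.
under eq_bigr => n _ do rewrite eqt mulrBr [X in _ - X]mulrCA.
rewrite sumrB -mulr_suml -mulr_sumr (eq_bigr _ (fun n _ => esym (tpow1 n))).
rewrite sum_tpow // mul0r sub0r !mulNr; congr (- (_ * _)).
rewrite (bigD1 m) //= eqxx mulr1 big1 ?addr0 ?tpow1 // => n /negPf->.
by rewrite mulr0.
Qed.

(** The dual orthogonality relation: a geometric sum in [c = psi n / psi m], evaluated by means of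
    c^p = c. *)
Lemma mult_inj_dual m n : m != 0 -> n != 0 ->
  \sum_(i < p | (0 < i)%N) psi n ^+ i * (psi m)^-1 ^+ i = p.-1%:R * (n == m)%:R.
Proof.
move=> m0 n0; have p0 := prime_gt0 p_pr; set c := psi n / psi m.
have -> : \sum_(i < p | (0 < i)%N) psi n ^+ i * (psi m)^-1 ^+ i = \sum_(i < p) c ^+ i - 1.
  rewrite [in RHS](bigD1 (Ordinal p0)) //= expr0 addrAC subrr add0r.
  by apply: eq_big => [i|i _]; rewrite -?exprMn // lt0n.
have [eqnm|nenm] := eqVneq n m.
  have -> : c = 1 by rewrite /c eqnm divff // mult_inj_eq0.
  rewrite mulr1 (eq_bigr (fun=> 1)) => [|i _]; last by rewrite expr1n.
  by rewrite sumr_const card_ord -{1}(prednK p0) mulrS addrAC subrr add0r.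
have c1 : c - 1 != 0.
  rewrite subr_eq0; apply: contra_neq nenm => c1; apply: psi_inj.
  by rewrite -[LHS](@divfK _ (psi m)) ?mult_inj_eq0 // -/c c1 mul1r.
have cp : c ^+ p = c.
  by rewrite /c -mult_injV -psiM -mult_injX -[X in _ ^+ X](card_Fp p_pr) expf_card.
by rewrite mulr0; apply/eqP; rewrite subr_eq0 -(inj_eq (mulfI c1)) -subrX1 cp mulr1.
Qed.

Lemma mult_inj_expand (f : 'F_p -> F) m : m != 0 ->
  p.-1%:R * f m = \sum_(i < p | (0 < i)%N)
    (\sum_(n : 'F_p | n != 0) f n * psi n ^+ i) * (psi m)^-1 ^+ i.
Proof.
move=> m0; under eq_bigr => i _ do rewrite mulr_suml.
rewrite exchange_big (bigD1 m) //= [X in _ + X]big1 => [|n].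
  under eq_bigr => i _ do rewrite -mulrA.
  by rewrite -mulr_sumr mult_inj_dual // eqxx mulr1 addr0 mulrC.
case/andP=> n0 /negPf nm; under eq_bigr => i _ do rewrite -mulrA.
by rewrite -mulr_sumr mult_inj_dual // nm !mulr0.
Qed.

(** The j-th Fourier coefficient on nonzero classes isolates theta^j among 1, theta, ...,
    theta^(p-1). The power theta^0 is supported at the class 0 and is therefore invisible. *)
Lemma sum_mult_inj_tpow i j : (i < p)%N -> (0 < j < p)%N ->
  \sum_(m | m != 0) psi m ^+ j * tpow i m = p.-1%:R * tpow i 1 * (i == j)%:R.
Proof.
move=> lip /andP[j0 ljp]; have p0 := prime_gt0 p_pr.
have [->|i0] := posnP i.
  rewrite eq_sym gtn_eqF // mulr0 big1 // => m /negPf m0.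
  by rewrite /= m0 mulr0.
transitivity (\sum_(m : 'F_p | m != 0) psi m ^+ j * (psi m)^-1 ^+ i * tpow i 1).
  by apply: eq_bigr => m m0; rewrite tpow_scale // mulrA.
rewrite -mulr_suml; have [->|nij] := eqVneq i j.
  by rewrite sum_mult_inj_diag mulr1.
rewrite sum_mult_inj ?mul0r ?mulr0 //.
rewrite -(prednK i0) -(prednK j0) -[i.-1.+1]addn1 -[j.-1.+1]addn1 eqn_modDr !modn_small; first last.
- by rewrite -ltnS !prednK.
- by rewrite -ltnS !prednK.
by apply: contra_neq nij => eqij; rewrite -(prednK i0) eqij prednK.
Qed.
End TwistedSums.

(** * Moments of the convolution powers over ['F_p] *)

Lemma Fp_fact_neq0 p i : prime p -> (i < p)%N -> (i`!)%:R != 0 :> 'F_p.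
Proof.
move=> p_pr ltip; rewrite -unitfE unitFpE //; elim: i ltip => [|i IH] lip.
  by rewrite fact0 coprimen1.
by rewrite factS coprimeMr IH ?(ltnW lip) // prime_coprime // gtnNdvd.
Qed.

(* Up to sign, convolution with theta acts on the moments in 'F_p as the
   derivation k |-> k M_(k-1), since theta has only its first moment nonzero. *)
Lemma Fp_tpow_moment p i : prime p -> odd p -> (i < p)%N ->
  \sum_m tpow (id : 'F_p -> 'F_p) i m * m ^+ i = (-1) ^+ i * (i`!)%:R.
Proof.
move=> p_pr p_odd; elim: i => [|i IH] lip.
  rewrite (bigD1 0) // big1 => [|m /negPf m0] /=; last by rewrite m0 mul0r.
  by rewrite !expr0 fact0 mul1r addr0.
transitivity (\sum_(n : 'F_p) \sum_l \sum_(k < i.+2)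
    n^-1 * tpow id i l * (n ^+ (i.+1 - k) * l ^+ k *+ 'C(i.+1, k))).
  transitivity (\sum_m \sum_(n : 'F_p) n^-1 * tpow id i (m - n) * m ^+ i.+1).
    by apply: eq_bigr => m _; rewrite /= mulr_suml.
  rewrite exchange_big; apply: eq_bigr => n _ /=.
  rewrite (reindex_inj (addIr n)); apply: eq_bigr => l _ /=.
  by rewrite addrK [l + n]addrC exprDn mulr_sumr.
rewrite exchange_big /=.
transitivity (\sum_(l : 'F_p) tpow id i l * l ^+ i * (- i.+1%:R)).
  apply: eq_bigr => l _; rewrite exchange_big /=.
  (* The sum over n is a power sum of exponent i - k over nonzero classes, nonzero only if p - 1
     divides i - k. Since i - k lies between -1 and p - 2 and p - 1 > 1, only k = i survives, with
     value p - 1 = -1. *)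
  have inner (k : nat) : (k <= i.+1)%N ->
      \sum_(n : 'F_p) n^-1 * tpow id i l * (n ^+ (i.+1 - k) * l ^+ k *+ 'C(i.+1, k))
      = (tpow id i l * l ^+ k *+ 'C(i.+1, k)) * (- (k == i)%:R).
    move=> lki.
    transitivity ((tpow id i l * l ^+ k *+ 'C(i.+1, k)) *
       \sum_(n : 'F_p | n != 0) n ^+ (i.+1 - k) * n^-1 ^+ 1).
      rewrite mulr_sumr (bigD1 0) //= invr0 !mul0r add0r; apply: eq_bigr => n _.
      by rewrite expr1 !mulrnAr !mulrnAl; congr (_ *+ _); rewrite mulrACA mulrC [n^-1 * _]mulrC.
    have [->|nki] := eqVneq k i.
      rewrite subSnn (sum_mult_inj_diag (psi := id)) //.
      congr (_ * _); apply/eqP; rewrite -addr_eq0 natr1 prednK ?prime_gt0 //.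
      by rewrite pchar_Fp_0.
    rewrite (sum_mult_inj (psi := id)) ?mulr0 ?oppr0 ?mulr0 //.
    have p1 : (1 < p.-1)%N by move: p_odd (prime_gt1 p_pr); case: (p) => [|[|[|[|]]]].
    move: lki nki p1 lip; rewrite leq_eqVlt => /orP[/eqP-> _ p1 _|].
      by rewrite subnn mod0n modn_small.
    rewrite ltnS => lki nki p1 lip.
    have {}nki : (1 < i.+1 - k)%N by rewrite subSn // ltnS subn_gt0 ltn_neqAle nki.
    rewrite modn_small //.
    have: (i.+1 - k <= p.-1)%N by rewrite (leq_trans (leq_subr _ _)) // -ltnS prednK ?prime_gt0.
    rewrite leq_eqVlt => /orP[/eqP->|lt]; first by rewrite modnn.
    by rewrite modn_small // ltn_eqF.
  rewrite (eq_bigr _ (fun (k : 'I_i.+2) _ => inner k (ltn_ord k))).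
  rewrite (bigD1 (Ordinal (ltnW (ltnSn i.+1)))) //=.
  rewrite big1 => [|k nk]; last by rewrite (negPf (_ : (k : nat) != i)) ?oppr0 ?mulr0.
  by rewrite addr0 eqxx binSn !mulrN mulr1 mulr_natr.
rewrite -mulr_suml IH ?(ltnW lip) // factS natrM exprS mulN1r mulrN mulNr -mulrA.
by rewrite [_%:R * _%:R]mulrC.
Qed.

(** If the coefficient at 1 vanished, so would those at all m != 0 by scaling, and with them the
    i-th moment; the class 0 adds nothing to it because i > 0. *)
Lemma Fp_tpow_neq0 p i : prime p -> odd p -> (0 < i < p)%N ->
  tpow (id : 'F_p -> 'F_p) i 1 != 0.
Proof.
move=> p_pr p_odd /andP[i0 lip].
apply: contra_neqN (Fp_fact_neq0 p_pr lip) => t0.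
have /eqP := Fp_tpow_moment p_pr p_odd lip.
rewrite big1 => [|m _]; first by rewrite eq_sym mulf_eq0 signr_eq0 => /eqP.
have [->|m0] := eqVneq m 0; first by rewrite expr0n gtn_eqF ?mulr0.
by rewrite tpow_scale // (eqP t0) mulr0 mul0r.
Qed.

(** * Valuations, reduction to ['F_p], and the Teichmüller coefficients as p-adic units *)

Section Valuation.
Variables (K : fieldType) (v : K -> int).
Hypothesis v_val : is_ndvaluation v.

Lemma ndvalM x y : x != 0 -> y != 0 -> v (x * y) = v x + v y.
Proof. by case: v_val => vM _ _; apply: vM. Qed.

Lemma ndval1 : v 1 = 0.
Proof.
have := ndvalM (oner_neq0 K) (oner_neq0 K).
by rewrite mulr1 -[LHS]addr0 => /addrI.
Qed.

Lemma ndvalN1 : v (-1) = 0.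
Proof.
have N10 : -1 != 0 :> K by rewrite oppr_eq0 oner_eq0.
by have /eqP := ndvalM N10 N10; rewrite mulrNN mulr1 ndval1 eq_sym -mulr2n mulrn_eq0 => /eqP.
Qed.

Lemma vgeW x m n : m <= n -> vge v x n -> vge v x m.
Proof. by move=> lmn [->|lx]; [left | right; apply: le_trans lx]. Qed.

Lemma vgeD x y n : vge v x n -> vge v y n -> vge v (x + y) n.
Proof.
have [-> _|x0] := eqVneq x 0; first by rewrite add0r.
have [-> + _|y0] := eqVneq y 0; first by rewrite addr0.
have [-> _ _|xy0] := eqVneq (x + y) 0; first by left.
case=> [/eqP|lx]; first by rewrite (negPf x0).
case=> [/eqP|ly]; first by rewrite (negPf y0).
right; case: v_val => _ vD _; apply: le_trans (vD _ _ x0 y0 xy0).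
by rewrite le_min lx ly.
Qed.

Lemma vgeM x y m n : vge v x m -> vge v y n -> vge v (x * y) (m + n).
Proof.
have [-> _ _|x0] := eqVneq x 0; first by left; rewrite mul0r.
have [-> _ _|y0] := eqVneq y 0; first by left; rewrite mulr0.
case=> [/eqP|lx]; first by rewrite (negPf x0).
case=> [/eqP|ly]; first by rewrite (negPf y0).
by right; rewrite ndvalM // lerD.
Qed.

Lemma vgeN x n : vge v x n -> vge v (- x) n.
Proof.
move=> vx; rewrite -mulN1r -[n]add0r; apply: vgeM => //.
by right; rewrite ndvalN1.
Qed.

Lemma vgeB x y n : vge v x n -> vge v y n -> vge v (x - y) n.
Proof. by move=> vx vy; apply/vgeD/vgeN. Qed.

Lemma vge_nat n : vge v n%:R 0.
Proof.
elim: n => [|n IH]; first by left.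
by rewrite -natr1; apply: vgeD => //; right; rewrite ndval1.
Qed.

Lemma vge_int z : vge v z%:~R 0.
Proof.
case: z => n; first exact: vge_nat.
by rewrite NegzE rmorphN; apply/vgeN/vge_nat.
Qed.

Lemma not_vge1 : ~ vge v 1 1.
Proof. by case=> [/eqP|]; rewrite ?oner_eq0 // ndval1. Qed.

Lemma Zp_int z : in_Zp v z%:~R.
Proof. by move=> N; exists z; left; rewrite subrr. Qed.

Lemma Zp_vge0 x : in_Zp v x -> vge v x 0.
Proof.
by move=> /(_ 0)[z vz]; rewrite -[x](subrK z%:~R); apply: vgeD => //; apply: vge_int.
Qed.

Lemma ZpD x y : in_Zp v x -> in_Zp v y -> in_Zp v (x + y).
Proof.
move=> Zx Zy N; have [[a va] [b vb]] := (Zx N, Zy N).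
by exists (a + b); rewrite rmorphD opprD addrACA; apply: vgeD.
Qed.

Lemma ZpM x y : in_Zp v x -> in_Zp v y -> in_Zp v (x * y).
Proof.
move=> Zx Zy N; have [[a va] [b vb]] := (Zx N, Zy N).
exists (a * b); rewrite (_ : _ - _ = (x - a%:~R) * y + a%:~R * (y - b%:~R)).
  apply: vgeD; first by rewrite -[N]addr0; apply: vgeM => //; apply: Zp_vge0.
  by rewrite -[N]add0r; apply: vgeM => //; apply: vge_int.
by rewrite mulrBl mulrBr addrA subrK rmorphM.
Qed.

Lemma ZpN x : in_Zp v x -> in_Zp v (- x).
Proof. by move=> Zx; rewrite -mulN1r; apply: ZpM => //; apply: (Zp_int (-1)). Qed.

Lemma Zp_sum (I : finType) (f : I -> K) :
  (forall i, in_Zp v (f i)) -> in_Zp v (\sum_i f i).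
Proof.
by move=> Zf; apply: big_ind => //; [apply: (Zp_int 0) | apply: ZpD].
Qed.

Variable p : nat.
Hypotheses (p_pr : prime p) (v_p : vge v p%:R 1).

(** Reduction modulo the maximal ideal, as a relation witnessed by a common integer; only elements
    congruent to integers occur, so no residue field is constructed. *)
Definition residue (a : K) (u : 'F_p) : Prop :=
  exists2 z : int, z%:~R = u & vge v (a - z%:~R) 1.

Lemma residueD a b u w : residue a u -> residue b w -> residue (a + b) (u + w).
Proof.
move=> [y <- vy] [z <- vz]; exists (y + z); first by rewrite rmorphD.
by rewrite rmorphD opprD addrACA; apply: vgeD.
Qed.

Lemma residue_vge a u : residue a u -> vge v a 0.
Proof.
move=> [y _ vy]; rewrite -[a](subrK y%:~R); apply: vgeD; last exact: vge_int.
exact: vgeW vy.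
Qed.

Lemma residueM a b u w : residue a u -> residue b w -> residue (a * b) (u * w).
Proof.
move=> ra rb; have va := residue_vge ra; case: ra rb => [y <- vy] [z <- vz].
exists (y * z); first by rewrite rmorphM.
rewrite (_ : _ - _ = (a - y%:~R) * z%:~R + a * (b - z%:~R)).
  apply: vgeD; first by rewrite -[X in vge _ _ X]addr0; apply: vgeM => //; apply: vge_int.
  by rewrite -[X in vge _ _ X]add0r; apply: vgeM.
by rewrite mulrBl mulrBr [RHS]addrC addrA subrK rmorphM.
Qed.

Lemma residue_nat n : residue n%:R n%:R.
Proof. by exists n%:Z; rewrite ?pmulrn // subrr; left. Qed.

Lemma residue_sum (I : finType) (f : I -> K) (u : I -> 'F_p) :
  (forall i, residue (f i) (u i)) -> residue (\sum_i f i) (\sum_i u i).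
Proof.
move=> rf; apply: (big_ind2 residue) => //; first exact: (residue_nat 0).
by move=> a b c d; apply: residueD.
Qed.

(** The integer representative has positive valuation, as has p; were it prime to p, a Bezout
    relation would give 1 positive valuation. *)
Lemma residue_vge1 a u : residue a u -> vge v a 1 -> u = 0.
Proof.
move=> [z <- vaz] va; apply/eqP; rewrite -(dvdz_pcharf (pchar_Fp p_pr)).
have vz : vge v z%:~R 1.
  by rewrite -[z%:~R](subKr a); apply: vgeB.
apply/negPn/negP => npz; apply: not_vge1.
have /coprimezP[[s t] /= st] : coprimez z p.
  by rewrite coprimez_sym coprimezE prime_coprime.
have -> : 1 = s%:~R * z%:~R + t%:~R * p%:R :> K.
  by rewrite pmulrn -!rmorphM -rmorphD st.
rewrite -[X in vge _ _ X]add0r.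
by apply: vgeD; apply: vgeM => //; apply: vge_int.
Qed.

Lemma residue_unit a u : residue a u -> u != 0 -> a != 0 /\ v a = 0.
Proof.
move=> ra u0; have nva : ~ vge v a 1 by move/(residue_vge1 ra)/eqP; apply/negP.
case: (residue_vge ra) => [a0|va]; first by case: nva; left.
split; first by apply/eqP => a0; apply: nva; left.
apply/eqP; rewrite eq_le va andbT leNgt; apply/negP => va1; apply: nva; right.
by rewrite -gtz0_ge1.
Qed.

Lemma residue_inj a u w : residue a u -> residue a w -> u = w.
Proof.
move=> [y yu vy] rw; have : residue (a - y%:~R) (w - u).
  rewrite -yu -mulN1r -[w - _]/(w + - _) -[- y%:~R]mulN1r; apply: residueD => //.
  by exists (- y); rewrite ?mulN1r ?rmorphN // subrr; left.
by move/residue_vge1 => /(_ vy)/eqP; rewrite subr_eq0 => /eqP.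
Qed.

Variable chi : 'F_p -> K.
Hypothesis chi_teich : is_teichmuller p v chi.

Lemma teich_residue m : residue (chi m) m.
Proof.
case: chi_teich => _ _ /(_ m)[z Zz em]; exists (m : nat)%:Z.
  by rewrite -pmulrn natr_Zp.
by rewrite -pmulrn em -[X in vge _ _ X]addr0; apply: vgeM => //; apply: Zp_vge0.
Qed.

Lemma teich_inj : injective chi.
Proof.
by move=> m n eqmn; apply: residue_inj (teich_residue m) _; rewrite eqmn; apply: teich_residue.
Qed.

Lemma teichM m n : chi (m * n) = chi m * chi n.
Proof. by case: chi_teich. Qed.

Lemma teichV m : chi m^-1 = (chi m)^-1.
Proof. exact: mult_injV teichM teich_inj m. Qed.

(** Inverses are rewritten as [chi m^-1], so every term is a sum of products of Teichmüller values
    and reduction commutes with convolution. *)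
Lemma residue_tpow i m : residue (tpow chi i m) (tpow id i m).
Proof.
elim: i m => [|i IH] m /=; first exact: residue_nat.
by apply: residue_sum => n; apply: residueM => //; rewrite -teichV; apply: teich_residue.
Qed.

Lemma Zp_tpow i m : in_Zp v (tpow chi i m).
Proof.
elim: i m => [|i IH] m /=; first by rewrite -[_%:R]/((m == 0)%:Z%:~R); apply: Zp_int.
by apply: Zp_sum => n; apply: ZpM => //; rewrite -teichV; case: chi_teich.
Qed.

Lemma tpow_teich_unit i : odd p -> (0 < i < p)%N -> in_Zp_units v (tpow chi i 1).
Proof.
move=> p_odd lip; split; first exact: Zp_tpow.
exact: residue_unit (residue_tpow i 1) (Fp_tpow_neq0 p_pr p_odd lip).
Qed.

End Valuation.

(** Coefficients are studied in K, where the valuation [vK] lives, and then transported to [Lt]. *)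
Lemma tpow_rmorph p (F E : fieldType) (f : {rmorphism F -> E}) (psi : 'F_p -> F) i m :
  tpow (f \o psi) i m = f (tpow psi i m).
Proof.
elim: i m => [|i IH] m /=; first by rewrite rmorph_nat.
by rewrite rmorph_sum; apply: eq_bigr => n _; rewrite rmorphM fmorphV IH.
Qed.

(** * The group algebra of <sigma> in coordinates indexed by ['F_p], and its tau-invariants *)

Section CyclicGroupAlgebra.
Variables (p : nat) (K : fieldType) (Lt : splittingFieldType K).
Variable sigma : gal_of (fullv : {vspace Lt}).
Hypotheses (p_pr : prime p) (order_sigma : #[sigma]%g = p).

Definition sg (m : 'F_p) := (sigma ^+ (m : nat))%g.

Lemma sg_nat n : sg n%:R = (sigma ^+ n)%g.
Proof. by rewrite /sg val_Fp_nat // -{1}order_sigma expg_mod_order. Qed.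

Lemma sgD m n : sg (m + n) = (sg m * sg n)%g.
Proof. by rewrite -[m]natr_Zp -[n]natr_Zp -natrD !sg_nat expgD. Qed.

Lemma sgB m n : sg (m - n) = (sg m * (sg n)^-1)%g.
Proof. by apply: (mulIg (sg n)); rewrite -sgD subrK mulgKV. Qed.

Lemma sg0 : sg 0 = 1%g. Proof. exact: expg0. Qed.

Lemma sg_inj : injective sg.
Proof.
move=> m n /eqP; rewrite eq_expg_mod_order order_sigma => /eqP eqmn.
by rewrite -[m]natr_Zp -[n]natr_Zp -[LHS]Fp_nat_mod // eqmn Fp_nat_mod.
Qed.

Lemma mem_sg m : sg m \in <[sigma]>%g. Proof. exact: mem_cycle. Qed.

Lemma sgP h : reflect (exists m, h = sg m) (h \in <[sigma]>%g).
Proof.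
apply: (iffP idP) => [/cycleP[n ->]|[m ->]]; last exact: mem_sg.
by exists n%:R; rewrite sg_nat.
Qed.

(** Indexing exponents by ['F_p] turns the product of the group algebra into additive
    convolution. *)
Definition gelt (f : 'F_p -> Lt) : galg Lt :=
  [ffun h => \sum_(m : 'F_p) if h == sg m then f m else 0].

Lemma gelt_sg f m : gelt f (sg m) = f m.
Proof.
rewrite ffunE (bigD1 m) //= eqxx big1 ?addr0 // => n.
by rewrite eq_sym (inj_eq sg_inj) => /negPf->.
Qed.

Lemma gelt_out f h : h \notin <[sigma]>%g -> gelt f h = 0.
Proof.
move=> hJ; rewrite ffunE big1 // => m _; case: eqP => // hm.
by rewrite hm mem_sg in hJ.
Qed.

Lemma eq_gelt (f : 'F_p -> Lt) (u : galg Lt) : (forall m, u (sg m) = f m) ->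
  (forall h, h \notin <[sigma]>%g -> u h = 0) -> u = gelt f.
Proof.
move=> uf u0; apply/ffunP => h; have [/sgP[m ->]|hJ] := boolP (h \in <[sigma]>%g).
  by rewrite uf gelt_sg.
by rewrite u0 // gelt_out.
Qed.

Lemma eq_gelt_fun f f' : f =1 f' -> gelt f = gelt f'.
Proof.
move=> eqf; apply: eq_gelt => [m|]; [by rewrite gelt_sg eqf | exact: gelt_out].
Qed.

Lemma galg_one_gelt : galg_one Lt = gelt (fun m => (m == 0)%:R).
Proof.
apply: eq_gelt => [m|h hJ]; rewrite ffunE -?sg0 ?(inj_eq sg_inj) //.
by case: eqP => // h0; rewrite h0 mem_sg in hJ.
Qed.

Lemma galg_mul_gelt f f' :
  galg_mul (gelt f) (gelt f') = gelt (fun m => \sum_n f n * f' (m - n)).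
Proof.
have mulE h : galg_mul (gelt f) (gelt f') h =
    \sum_n f n * gelt f' (h * (sg n)^-1)%g.
  rewrite ffunE (eq_bigr (fun k => \sum_n if k == sg n then f n * gelt f' (h * k^-1)%g else 0)).
    by rewrite exchange_big; apply: eq_bigr => n _; rewrite -big_mkcond big_pred1_eq.
  move=> k _; rewrite [gelt f k]ffunE mulr_suml; apply: eq_bigr => n _.
  by case: eqP; rewrite ?mul0r.
apply: eq_gelt => [m|h hJ]; rewrite mulE.
  by apply: eq_bigr => n _; rewrite -sgB gelt_sg.
by apply: big1 => n _; rewrite gelt_out ?mulr0 // groupMr // groupV mem_sg.
Qed.

Lemma galg_exp_gelt z (psi : 'F_p -> Lt) i :
  galg_exp (gelt (fun m => z * (psi m)^-1)) i = gelt (fun m => z ^+ i * tpow psi i m).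
Proof.
elim: i => [|i IH].
  rewrite /galg_exp /= galg_one_gelt; apply: eq_gelt_fun => m.
  by rewrite mul1r.
rewrite /galg_exp iterS -/(galg_exp _ i) IH galg_mul_gelt.
apply: eq_gelt_fun => m /=; rewrite mulr_sumr; apply: eq_bigr => n _.
by rewrite exprS mulrACA.
Qed.

Variables (tau : gal_of (fullv : {vspace Lt})) (g : nat).
Hypothesis tau_sigma : (tau^-1 * sigma * tau)%g = (sigma ^+ g)%g.

Lemma sg_conj m : (tau^-1 * sg m * tau)%g = sg (g%:R * m).
Proof. by rewrite -mulgA -conjgE conjXg conjgE mulgA tau_sigma -expgM -sg_nat natrM natr_Zp. Qed.

Lemma galg_act_sg u m : galg_act tau u (sg (g%:R * m)) = tau (u (sg m)).
Proof.
rewrite ffunE -sg_conj; congr (gal_repr tau (u _)).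
by rewrite !mulgA mulgV mul1g mulgK.
Qed.

(** Conjugation by tau multiplies exponents by g, so invariance becomes an equivariance of the
    coefficient function. *)
Lemma in_H_gelt (M : {vspace Lt}) (J : {set gal_of {:Lt}}) u :
  (g%:R : 'F_p) != 0 -> J = <[sigma]>%g ->
  in_H M J tau u <-> exists f, [/\ u = gelt f, forall m, f m \in M
                               & forall m, tau (f m) = f (g%:R * m)].
Proof.
move=> g0 ->; split=> [[uMJ tau_u]|[f [-> fM tau_f]]].
  exists (fun m => u (sg m)); split=> [|m|m].
  - by apply: eq_gelt => // h hJ; apply: (uMJ h).2.
  - exact: (uMJ _).1.
  - by rewrite -galg_act_sg tau_u.
split=> [h|].
  split; last exact: gelt_out.
  have [/sgP[m ->]|hJ] := boolP (h \in <[sigma]>%g); first by rewrite gelt_sg.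
  by rewrite gelt_out // mem0v.
apply: eq_gelt => [m|h hJ].
  by rewrite -(mulVKf g0 m) galg_act_sg gelt_sg tau_f.
rewrite ffunE gelt_out ?raddf0 //; apply: contra hJ => /sgP[m hm].
by apply/sgP; exists (g%:R * m); rewrite -sg_conj -hm !mulgA mulVg mul1g mulgKV.
Qed.

End CyclicGroupAlgebra.

(** * Compatibility of Galois automorphisms with the field operations *)

Section GalMorphism.
Variables (K : fieldType) (Lt : splittingFieldType K).
Variable s : gal_of (fullv : {vspace Lt}).

Lemma galrM a b : s (a * b) = s a * s b. Proof. exact: rmorphM. Qed.

Lemma galrX a n : s (a ^+ n) = s a ^+ n. Proof. exact: rmorphXn. Qed.

Lemma galrV a : s a^-1 = (s a)^-1. Proof. exact: fmorphV. Qed.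

Lemma galrB a b : s (a - b) = s a - s b. Proof. exact: rmorphB. Qed.

Lemma galr_sum (I : finType) (P : pred I) (f : I -> Lt) :
  s (\sum_(i | P i) f i) = \sum_(i | P i) s (f i).
Proof. exact: rmorph_sum. Qed.

Lemma galr_alg (k : K) : s k%:A = k%:A.
Proof. by rewrite [LHS]linearZ /= rmorph1. Qed.
End GalMorphism.

(** * Freeness and spanning for the functions z^i theta^i *)

Section TwistedBasis.
Variables (p : nat) (K : fieldType) (Lt : splittingFieldType K) (psi : 'F_p -> K).
Hypothesis p_pr : prime p.
Hypothesis psiM : forall m n, psi (m * n) = psi m * psi n.
Hypothesis psi_inj : injective psi.
Hypothesis psi_tpow : forall i, (0 < i < p)%N -> tpow psi i 1 != 0.
Hypothesis p1_neq0 : p.-1%:R != 0 :> K.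
Variable z : Lt.
Hypothesis z0 : z != 0.

Local Notation psiL := (in_alg Lt \o psi).

Let psiLM m n : psiL (m * n) = psiL m * psiL n.
Proof. by rewrite /comp psiM rmorphM. Qed.

Let psiL_inj : injective psiL.
Proof. by move=> m n /(fmorph_inj (in_alg Lt))/psi_inj. Qed.

Let psiL_tpow i : (0 < i < p)%N -> p.-1%:R * tpow psiL i 1 != 0.
Proof.
move=> ip; rewrite tpow_rmorph -(rmorph_nat (in_alg Lt)) -rmorphM fmorph_eq0.
by rewrite mulf_neq0 ?psi_tpow.
Qed.

(** Fourier coefficients on nonzero classes kill [cf j] for j > 0; evaluation at m = 0 then kills
    the remaining constant term. *)
Lemma twisted_free (cf : 'I_p -> K) :
  (forall m, \sum_(i < p) (cf i)%:A * (z ^+ i * tpow psiL i m) = 0) ->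
  forall i, cf i = 0.
Proof.
move=> cf0.
have cf_pos (j : 'I_p) : (0 < j)%N -> cf j = 0.
  move=> j0; have jp : (0 < j < p)%N by rewrite j0 ltn_ord.
  have: \sum_(m | m != 0) psiL m ^+ j *
      \sum_(i < p) (cf i)%:A * (z ^+ i * tpow psiL i m) = 0.
    by rewrite big1 // => m _; rewrite cf0 mulr0.
  under eq_bigr => m _ do rewrite mulr_sumr.
  rewrite exchange_big (bigD1 j) //= [X in _ + X]big1 ?addr0.
    under eq_bigr => m _ do rewrite mulrCA [_ ^+ _ * (_ * _)]mulrCA mulrA.
    rewrite -mulr_sumr (sum_mult_inj_tpow p_pr psiLM psiL_inj) ?ltn_ord ?j0 //.
    move/eqP; rewrite eqxx mulr1 mulf_eq0 (negPf (psiL_tpow jp)) orbF mulf_eq0.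
    by rewrite expf_eq0 (negPf z0) andbF orbF (fmorph_eq0 (in_alg Lt)) => /eqP.
  move=> i nij; under eq_bigr => m _ do rewrite mulrCA [_ ^+ _ * (_ * _)]mulrCA mulrA.
  rewrite -mulr_sumr (sum_mult_inj_tpow p_pr psiLM psiL_inj) ?ltn_ord ?j0 //.
  by rewrite (negPf (_ : (i : nat) != j)) ?mulr0.
move=> i; have [i0|] := posnP i; last exact: cf_pos.
have := cf0 0; rewrite (bigD1 i) //= [X in _ + X]big1 ?addr0 => [|j nji].
  by rewrite i0 /= !mulr1 => /eqP; rewrite (fmorph_eq0 (in_alg Lt)) => /eqP.
by rewrite cf_pos ?scale0r ?mul0r // lt0n -i0.
Qed.

Variables (M : {subfield Lt}) (tau : gal_of (fullv : {vspace Lt})) (u : 'F_p).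
Hypotheses (u0 : u != 0) (zM : z \in M) (tau_z : tau z = (psi u)^-1%:A * z).

(** The factor [psi u ^- i] produced by tau on z^i is exactly the one produced by scaling m by u. *)
Lemma tau_twisted i m : tau (z ^+ i * tpow psiL i m) = z ^+ i * tpow psiL i (u * m).
Proof.
rewrite (tpowM psiLM) // galrM galrX tau_z tpow_rmorph galr_alg exprMn.
by rewrite -mulrA mulrCA -(fmorphV (in_alg Lt)).
Qed.

Lemma twisted_mem i m : z ^+ i * tpow psiL i m \in M.
Proof. by rewrite tpow_rmorph mulr_algr memvZ // rpredX. Qed.

Hypothesis fixed : forall a, a \in M -> tau a = a -> exists k : K, a = k%:A.

Lemma twisted_span (F : 'F_p -> Lt) :
  (forall m, F m \in M) -> (forall m, tau (F m) = F (u * m)) ->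
  exists cf : 'I_p -> K, forall m,
    F m = \sum_(i < p) (cf i)%:A * (z ^+ i * tpow psiL i m).
Proof.
move=> FM tauF; have p0 := prime_gt0 p_pr; pose o := Ordinal p0.
pose a i := \sum_(n : 'F_p | n != 0) F n * psiL n ^+ i.
have aM i : a i \in M.
  by apply: rpred_sum => n _; rewrite -rmorphXn mulr_algr memvZ.
have tau_a i : tau (a i) = (psiL u)^-1 ^+ i * a i.
  rewrite /a galr_sum [in RHS](reindex_inj (mulfI u0)) mulr_sumr.
  apply: eq_big => [n|n n0]; first by rewrite mulf_eq0 negb_or u0.
  rewrite galrM tauF psiLM exprMn mulrCA; congr (_ * _).
  rewrite mulrA -exprMn mulVf ?expr1n ?mul1r; last first.
    by rewrite (mult_inj_eq0 psiLM psiL_inj).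
  by rewrite galrX galr_alg.
(* The Fourier coefficient [a i] and z^i are twisted by tau in the same way, so their quotient is
   fixed and descends to K. *)
have /fin_all_exists[k ak] : forall i : 'I_p, exists c : K, a i / z ^+ i = c%:A.
  move=> i; apply: fixed; first by rewrite rpredM ?rpredV ?rpredX.
  rewrite galrM galrV galrX tau_a tau_z exprMn invfM mulrACA.
  rewrite -(fmorphV (in_alg Lt)) divff ?mul1r // expf_neq0 // fmorph_eq0 invr_eq0.
  by rewrite (mult_inj_eq0 psiM psi_inj).
(* The divisor removes the factor p - 1 of Fourier inversion and the coefficient f_i of theta^i. *)
pose c i := k i / (p.-1%:R * tpow psi i 1).
pose S m := \sum_(i < p | (0 < i)%N) (c i)%:A * (z ^+ i * tpow psiL i m).
have FS m : m != 0 -> F m = S m.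
  move=> m0; apply: (mulfI (x := p.-1%:R)).
    by rewrite -(rmorph_nat (in_alg Lt)) fmorph_eq0.
  rewrite (mult_inj_expand p_pr psiLM psiL_inj) // mulr_sumr; apply: eq_bigr => i i0.
  rewrite (tpow_scale psiLM) //.
  have ip : (0 < i < p)%N by rewrite i0 ltn_ord.
  have ck : (c i)%:A * (p.-1%:R * tpow psiL i 1) = (k i)%:A.
    rewrite tpow_rmorph -(rmorph_nat (in_alg Lt)) -!(rmorphM (in_alg Lt)) /c.
    by rewrite divfK // mulf_neq0 ?psi_tpow.
  rewrite -/(a i) -[a i](@divfK _ (z ^+ i)) ?expf_neq0 // ak -ck.
  rewrite [RHS]mulrCA -!mulrA; congr (_ * (_ * _)).
  by rewrite mulrC -mulrA.
(* Inversion sees only m != 0; the discrepancy at 0 is fixed by tau and is absorbed by the power i =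
   0, supported there. *)
have /fixed[|k0 Fk0] : F 0 - S 0 \in M.
- rewrite rpredB // rpred_sum // => i _.
  by rewrite mulr_algl memvZ // twisted_mem.
- rewrite galrB tauF mulr0 galr_sum; congr (_ - _); apply: eq_bigr => i _.
  by rewrite galrM tau_twisted mulr0 galr_alg.
exists (fun i => if i == o then k0 else c i) => m.
rewrite (bigD1 o) //= mul1r.
have -> : \sum_(i < p | i != o) (if i == o then k0 else c i)%:A * (z ^+ i * tpow psiL i m) = S m.
  by apply: eq_big => [i|i /negPf->]; rewrite ?lt0n.
have [->|m0] := eqVneq m 0; first by rewrite mulr1 -Fk0 subrK.
by rewrite mulr0 add0r FS.
Qed.
End TwistedBasis.

(** * Subfields of coprime degrees, and the theorem in the typical setting *)

Lemma coprime_dim_cap (K : fieldType) (Lt : fieldExtType K) (L M : {subfield Lt}) a :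
  coprime (\dim L) (\dim M) -> a \in L -> a \in M -> exists k : K, a = k%:A.
Proof.
move=> cLM aL aM; have aLM : a \in (L :&: M)%VS by rewrite memv_cap aL.
(* The degree of the intersection divides both degrees. *)
have d1 : \dim (L :&: M)%AS = 1%N.
  apply/eqP; rewrite -dvdn1 -(eqP cLM) dvdn_gcd.
  by rewrite !field_dimS ?capvSl ?capvSr.
have : a \in 1%VS.
  suff /eqP-> : 1%VS == (L :&: M)%VS by [].
  by rewrite eqEdim sub1v /= d1 dimv1.
by case/vlineP => k ->; exists k.
Qed.

Lemma sum_Fp_nat (p : nat) (V : nmodType) (f : nat -> V) : prime p ->
  \sum_(m : 'F_p) f m = \sum_(m < p) f m.
Proof. by move=> p_pr; rewrite -!(big_mkord xpredT f) Fp_cast. Qed.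

Unset Implicit Arguments.

Theorem theorem5p7
  (p : nat) (K : fieldType) (vK : K -> int)
  (HK : padic_local_field p vK) (Hp_odd : odd p)
  (chi : 'F_p -> K) (Hchi : is_teichmuller p vK chi)
  (Lt : splittingFieldType K) (vLt : Lt -> int)
  (L M : {subfield Lt}) (r : nat)
  (J : {group gal_of (fullv : {vspace Lt})})
  (sigma tau : gal_of (fullv : {vspace Lt})) (g : nat)
  (x y : Lt) (alpha beta : K) (t c : nat) (b : int) :
  (* L/K has degree p, Lt is its normal closure, Galois over K *)
  \dim L = p ->
  galois 1%VS (fullv : {vspace Lt}) ->
  (forall E : {subfield Lt}, (L <= E)%VS -> normalField 1%VS E -> E = fullv :> {vspace Lt}) ->
  r = \dim_L (fullv : {vspace Lt}) ->
  (* Lt/K totally ramified: the normalized valuation of Lt restricts to [Lt:K] v_K *)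
  is_ndvaluation vLt ->
  (forall a : K, a != 0 -> vLt a%:A = (\dim (fullv : {vspace Lt}))%:Z * vK a) ->
  (* J the subgroup of order p, generated by sigma; M = Lt^J; G' = Gal(Lt/L) = <tau> *)
  J \subset 'Gal(fullv / 1%VS) -> #|J| = p ->
  J = <[sigma]>%G :> {set _} ->
  'Gal(fullv / L) = <[tau]> ->
  (M : {vspace Lt}) = fixedField J ->
  (* ramification jump t: G_t = J, G_{t+1} = 1 (lower numbering) *)
  (forall s, s \in 'Gal(fullv / 1%VS) ->
     (s \in J <-> forall a, vge vLt a 0 -> vge vLt (s a - a) (t%:Z + 1))) ->
  (forall s, s \in 'Gal(fullv / 1%VS) ->
     (forall a, vge vLt a 0 -> vge vLt (s a - a) (t%:Z + 2)) -> s = 1%g) ->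
  (* typical: p does not divide t *)
  ~~ (p %| t)%N ->
  c = (t %% r)%N -> r%:Z * b = t%:Z - (p * c)%N%:Z ->
  (* Elder's theorem data *)
  alpha != 0 -> beta != 0 ->
  vK alpha = c%:Z -> vK beta = - b ->
  x ^+ p - (alpha ^+ ((p - 1) %/ r))%:A * x - beta%:A = 0 ->
  (L : {vspace Lt}) = <<1%VS; x>>%VS ->
  y \in M -> y ^+ r = alpha%:A ->
  (M : {vspace Lt}) = <<1%VS; y>>%VS ->
  (fullv : {vspace Lt}) = <<L; y>>%VS ->
  (* tau o sigma o tau^-1 = sigma^g *)
  (tau^-1 * sigma * tau)%g = (sigma ^+ g)%g ->
  (g ^ r = 1 %[mod p])%N ->
  (forall k, (0 < k < r)%N -> (g ^ k != 1 %[mod p])%N) ->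
  sigma y = y -> tau x = x -> tau y = (chi g%:R)%:A * y ->
  let w : galg Lt := [ffun h => \sum_(m < p | (0 < m)%N)
                        if h == (sigma ^+ m)%g
                        then y ^+ (r - 1) * ((chi m%:R)^-1)%:A else 0] in
  [/\ in_H M J tau w,
      (* 1, w, ..., w^(p-1) is a K-basis of H *)
      (forall f, in_H M J tau f <->
         exists cf : 'I_p -> K,
           f = [ffun h => \sum_(i < p) (cf i)%:A * galg_exp w i h]),
      (forall cf : 'I_p -> K,
         [ffun h => \sum_(i < p) (cf i)%:A * galg_exp w i h] = [ffun => 0] ->
         forall i, cf i = 0)
    & exists eps : K, in_Zp_units vK eps /\
        galg_exp w p =
          galg_scale ((eps * p%:R)%:A * y ^+ ((p - 1) * (r - 1))) w].

Proof.
move=> dimL galK _ rE _ _ _ cardJ Jsig galL Mfix _ _ _ _ _ al0 _ _ _ _ _ yM yr _ _.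
move=> tau_sig gr1 gmin _ _ tauy w.
have [p_pr char0 v_val _ [_ [_ vp]]] := HK.
have v_p : vge vK p%:R 1 by right; rewrite -gtz0_ge1.
have p0 := prime_gt0 p_pr; have p1 := prime_gt1 p_pr.
have chiM := teichM Hchi.
have chi_inj := teich_inj v_val p_pr v_p Hchi.
have chi_unit i : (0 < i < p)%N -> in_Zp_units vK (tpow chi i 1).
  exact: tpow_teich_unit.
have p1n0 : p.-1%:R != 0 :> K.
  by have /pcharf0P-> := char0; rewrite -lt0n -subn1 subn_gt0.
have os : #[sigma]%g = p by rewrite -cardJ Jsig.
have r0 : (0 < r)%N.
  by rewrite rE divn_gt0 ?adim_gt0 // dimvS // subvf.
have gr : (g%:R : 'F_p) ^+ r = 1.
  by rewrite -natrX -Fp_nat_mod // gr1 Fp_nat_mod.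
have g0 : g%:R != 0 :> 'F_p.
  by apply: contra_eq_neq gr => ->; rewrite expr0n gtn_eqF // eq_sym oner_neq0.
(* Otherwise p - 1 is a positive exponent below r, and Fermat's g^(p-1) = 1 contradicts the
   minimality of r. *)
have rp : (r < p)%N.
  rewrite ltnNge; apply/negP => lpr; have := gmin p.-1.
  rewrite -subn1 subn_gt0 p1 subn1 prednK // lpr => /(_ isT)/eqP; apply.
  rewrite -!(val_Fp_nat p_pr); congr (nat_of_ord _); rewrite natrX.
  by apply: (mulfI g0); rewrite -exprS prednK // mulr1 -[X in _ ^+ X](card_Fp p_pr) expf_card.
(* The degree of [Lt] over K is counted twice: through M, with top degree #|J| = p, and through L,
   as p r. *)
have dimM : \dim M = r.
  apply/eqP; rewrite -(eqn_pmul2l p0).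
  have dimML : \dim_M {:Lt} = p by rewrite Mfix -dim_fixedField.
  rewrite -{1}dimML -dim_sup_field ?subvf // rE mulnC -{1}dimL.
  by rewrite -dim_sup_field ?subvf.
(* As tau generates Gal(Lt/L), such an element lies in L as well as M, whose degrees p and r < p are
   coprime. *)
have fixed a : a \in M -> tau a = a -> exists k : K, a = k%:A.
  move=> aM ta; apply: (@coprime_dim_cap _ _ L M a) aM.
    by rewrite dimL dimM prime_coprime // gtnNdvd.
  have /galois_fixedField <- : galois L {:Lt} by apply: galoisS galK; rewrite sub1v subvf.
  apply/fixedFieldP; first exact: memvf.
  rewrite galL => _ /cycleP[n ->]; elim: n => [|n IH]; first by rewrite gal_id.
  by rewrite expgS galM ?memvf // ta IH.
have y0 : y != 0.
  apply: contraNneq al0 => y0; rewrite -(fmorph_eq0 (in_alg Lt)) /= -yr y0.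
  by rewrite expr0n gtn_eqF.
set z := y ^+ (r - 1).
have z0 : z != 0 by rewrite expf_neq0.
have zM : z \in M by rewrite rpredX.
(* The exponent r - 1 is chosen for this: g^r = 1 in ['F_p] gives chi(g)^(r-1) = chi(g)^-1. *)
have tau_z : tau z = (chi g%:R)^-1%:A * z.
  rewrite galrX tauy exprMn -[_ ^+ (r - 1)](rmorphXn (in_alg Lt)); congr (_%:A * _).
  apply: (mulfI (x := chi g%:R)); first by rewrite (mult_inj_eq0 chiM chi_inj).
  rewrite -exprS subn1 prednK // divff ?(mult_inj_eq0 chiM chi_inj) //.
  by rewrite -(mult_injX chiM chi_inj) gr (mult_inj1 chiM chi_inj).
(* The index 0, excluded in [w], may be included, because chi(0) = 0 has inverse 0. *)
have wE : w = gelt sigma (fun m => z * ((in_alg Lt \o chi) m)^-1).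
  apply/ffunP => h; rewrite !ffunE big_mkcond /=.
  rewrite -(@sum_Fp_nat p _ (fun n => if (0 < n)%N then if h == (sigma ^+ n)%g
    then y ^+ (r - 1) * ((chi n%:R)^-1)%:A else 0 else 0)) //.
  apply: eq_bigr => n _; rewrite natr_Zp -/(sg sigma n) -(fmorphV (in_alg Lt)).
  have [n0|//] := posnP n.
  have -> : n = 0 by apply/val_inj.
  by rewrite (mult_inj0 chiM chi_inj) invr0 rmorph0 mulr0 if_same.
have wX i : galg_exp w i = gelt sigma (fun m => z ^+ i * tpow (in_alg Lt \o chi) i m).
  by rewrite wE galg_exp_gelt.
have inH := in_H_gelt p_pr os tau_sig.
have combE (cf : 'I_p -> K) : [ffun h => \sum_(i < p) (cf i)%:A * galg_exp w i h] =
    gelt sigma (fun m => \sum_(i < p) (cf i)%:A * (z ^+ i * tpow (in_alg Lt \o chi) i m)).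
  apply: eq_gelt => // [m|h hJ]; rewrite ffunE.
    by apply: eq_bigr => i _; rewrite wX gelt_sg.
  by rewrite big1 // => i _; rewrite wX gelt_out ?mulr0.
have combH (cf : 'I_p -> K) :
    in_H M J tau [ffun h => \sum_(i < p) (cf i)%:A * galg_exp w i h].
  rewrite combE; apply/inH => //; eexists; split; first reflexivity.
    by move=> m; apply: rpred_sum => i _; rewrite mulr_algl memvZ // twisted_mem.
  move=> m; rewrite galr_sum; apply: eq_bigr => i _.
  by rewrite galrM galr_alg (tau_twisted chiM g0 tau_z).
split.
- apply/inH => //; exists (fun m => z ^+ 1 * tpow (in_alg Lt \o chi) 1 m); split.
  + by rewrite wE; apply: eq_gelt_fun => // m; rewrite tpow1.
  + by move=> m; apply: twisted_mem.
  + by move=> m; apply: tau_twisted.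
- move=> f; split=> [/inH[//|//|F [-> FM tauF]]|[cf ->]//].
  have [cf Fcf] : exists cf : 'I_p -> K, forall m,
      F m = \sum_(i < p) (cf i)%:A * (z ^+ i * tpow (in_alg Lt \o chi) i m).
    apply: (@twisted_span p K Lt chi p_pr chiM chi_inj _ p1n0 z z0 M tau g%:R) => // i ip.
    by have [_ []] := chi_unit i ip.
  by exists cf; rewrite combE; apply: eq_gelt_fun.
- move=> cf; rewrite combE => cf0.
  apply: (@twisted_free p K Lt chi p_pr chiM chi_inj _ p1n0 z z0) => [i ip|m].
    by have [_ []] := chi_unit i ip.
  by have := congr1 (fun u : galg Lt => u (sg sigma m)) cf0; rewrite gelt_sg // ffunE.
- have [|ZpB [B0 vB]] := chi_unit p.-1.
    by rewrite prednK // leqnn andbT -subn1 subn_gt0.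
  (* The unit is read off theta^p = - p f_(p-1) theta; the power of y comes from z^p = z^(p-1) z. *)
  exists (- tpow chi p.-1 1); split.
    split; first exact: ZpN.
    by rewrite oppr_eq0 -mulN1r (ndvalM v_val) ?oppr_eq0 ?oner_eq0 // (ndvalN1 v_val) vB.
  rewrite wX wE; apply/esym/eq_gelt => // [m|h hJ]; rewrite ffunE; last first.
    by rewrite gelt_out ?mulr0.
  rewrite gelt_sg // tpow_rmorph (tpow_p p_pr Hp_odd chiM chi_inj) tpow1.
  have zp : z ^+ p = y ^+ ((p - 1) * (r - 1)) * z.
    by rewrite mulnC exprM -/z subn1 -exprSr prednK.
  rewrite zp (rmorphM (in_alg Lt)) (fmorphV (in_alg Lt)) [- _ * _%:R]mulrC mulrN -mulNr.
  by rewrite [_%:A * _]mulrC mulrACA.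
Qed.
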